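(* Let $W \subset \mathbb{R}^2$ be the Warsaw Circle. Then the zeroth Milnor-Thurston homology group $\mathcal{H}_0(W)$ is a real vector space of uncountable dimension.
   Context: The Warsaw Circle $W \subset \mathbb{R}^2$ is the union of: the portion of the topologist's sine curve $\{(x,y) : y = \sin(1/x),\ x>0\}$ between the line $x=0$ and its rightmost minimum; the segment $\{(0,y) : -1 \leq y \leq 1\}$; and an arc (disjoint from the rest except at endpoints) joining $(0,-1)$ to that rightmost minimum. Milnor-Thurston (measure) homology: for a topological space $X$ and integer $k \geq 0$, let $C^0(\Delta^k, X)$ be the space of continuous maps from the standard $k$-simplex $\Delta^k$ to $X$, with the compact-open topology. $\mathcal{C}_k(X)$ is the real vector space of finite signed Borel measures on $C^0(\Delta^k,X)$ admitting a compact carrier (a set whose complement contains only Borel sets of measure zero). The boundary $\partial : \mathcal{C}_k(X) \to \mathcal{C}_{k-1}(X)$ is $\partial = \sum_{i=0}^k (-1)^i \partial_i$, where $\partial_i \mu$ is the image measure $A \mapsto \mu(\{\sigma : \sigma\circ\delta_i \in A\})$, with $\delta_i : \Delta^{k-1} \to \Delta^k$ the standard inclusion of the $i$-th face. The homology $\mathcal{H}_*(X)$ of this chain complex is the Milnor-Thurston homology of $X$. *)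

(* Defs.v *)
From HB Require Import structures.
From mathcomp Require Import all_boot all_order all_algebra.
From mathcomp Require Import all_classical all_reals all_analysis.
Unset Printing Implicit Defensive.
Import Order.TTheory GRing.Theory Num.Theory.
Import numFieldNormedType.Exports.
Local Open Scope classical_set_scope.
Local Open Scope ring_scope.

(* x-coordinate of the rightmost minimum of sin(1/x), x > 0:
   1/x = 3 pi / 2, i.e. x = 2 / (3 pi). *)
Definition wx0 (R : realType) : R := 2 / (3 * pi).

Definition sine_part (R : realType) : set (R * R) :=
  [set p | 0 < p.1 <= wx0 R /\ p.2 = sin (p.1)^-1].

Definition limit_segment (R : realType) : set (R * R) :=
  [set p | p.1 = 0 /\ -1 <= p.2 <= 1].

Definition unit_interval (R : realType) : set R := [set t | 0 <= t <= 1].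

Definition warsaw_arc (R : realType) (g : R -> R * R) : Prop :=
  [/\ {within (unit_interval R), continuous g},
      set_inj (unit_interval R) g,
      g 0 = (0, -1), g 1 = (wx0 R, -1) &
      forall t, 0 < t < 1 -> ~ sine_part R (g t) /\ ~ limit_segment R (g t)].

Definition warsaw_circle (R : realType) (g : R -> R * R) : set (R * R) :=
  sine_part R `|` limit_segment R `|` g @` unit_interval R.

Definition std_simplex (R : realType) (k : nat) : set 'rV[R]_(k.+1) :=
  [set t | (forall j, 0 <= t ord0 j) /\ \sum_(j < k.+1) t ord0 j = 1].

Definition Simplex (R : realType) (k : nat) : topologicalType :=
  set_type (std_simplex R k).

Definition face_map (R : realType) (k : nat) (i : 'I_(k.+2))
    (t : 'rV[R]_(k.+1)) : 'rV[R]_(k.+2) :=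
  \row_(j < k.+2) match unlift i j with Some j' => t ord0 j' | None => 0 end.

Definition Sing (R : realType) (X : topologicalType) (k : nat) : topologicalType :=
  set_type [set f : {compact-open, Simplex R k -> X} | continuous f].

Definition borel (T : topologicalType) : set (set T) := <<s open >>.

(* finite signed Borel measure (countably additive, real-valued);
   values on non-Borel sets are irrelevant *)
Definition signed_borel_measure (R : realType) (T : topologicalType)
    (mu : set T -> R) : Prop :=
  mu set0 = 0 /\
  forall F : nat -> set T, (forall n, borel T (F n)) -> trivIset setT F ->
    (fun n => \sum_(m < n) mu (F m)) @ \oo --> mu (\bigcup_n F n).

Definition has_compact_carrier (R : realType) (T : topologicalType)
    (mu : set T -> R) : Prop :=
  exists K : set T, compact K /\
    forall A, borel T A -> A `<=` ~` K -> mu A = 0.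

Definition mt_chain (R : realType) (X : topologicalType) (k : nat)
    (mu : set (Sing R X k) -> R) : Prop :=
  signed_borel_measure R _ mu /\ has_compact_carrier R _ mu.

Definition is_face (R : realType) (X : topologicalType) (k : nat) (i : 'I_(k.+2))
    (sigma : Sing R X k.+1) (tau : Sing R X k) : Prop :=
  forall (x : Simplex R k) (y : Simplex R k.+1),
    set_val y = face_map R k i (set_val x) ->
    (set_val tau : Simplex R k -> X) x = (set_val sigma : Simplex R k.+1 -> X) y.

Definition face_op (R : realType) (X : topologicalType) (k : nat) (i : 'I_(k.+2))
    (mu : set (Sing R X k.+1) -> R) : set (Sing R X k) -> R :=
  fun A => mu [set sigma | exists tau, is_face R X k i sigma tau /\ A tau].

Definition mt_boundary (R : realType) (X : topologicalType) (k : nat)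
    (mu : set (Sing R X k.+1) -> R) : set (Sing R X k) -> R :=
  fun A => \sum_(i < k.+2) (-1) ^+ i * face_op R X k i mu A.

Definition mt_boundary0 (R : realType) (X : topologicalType)
    (nu : set (Sing R X 0) -> R) : Prop :=
  exists mu, mt_chain R X 1 mu /\ forall A, borel _ A -> mt_boundary R X 0 mu A = nu A.

(* H_0(X) = C_0(X) / partial C_1(X) has uncountable dimension:
   there is an uncountable family of 0-chains whose classes in H_0(X)
   are linearly independent *)
Definition MT_H0_uncountable_dim (R : realType) (X : topologicalType) : Prop :=
  exists (I : Type) (nu : I -> set (Sing R X 0) -> R),
    [/\ ~ countable [set: I],
        forall i, mt_chain R X 0 (nu i) &
        forall (n : nat) (f : 'I_n -> I) (c : 'I_n -> R),
          injective f -> (exists j, c j != 0) ->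
          ~ mt_boundary0 R X (fun A => \sum_(j < n) c j * nu (f j) A)].

Definition Warsaw (R : realType) (g : R -> R * R) : topologicalType :=
  set_type (warsaw_circle R g).

(* Main.v *)
Require Import Defs.
From HB Require Import structures.
From mathcomp Require Import all_boot all_order all_algebra.
From mathcomp Require Import all_classical all_reals all_analysis.
From mathcomp Require Import ring lra.
Set Implicit Arguments.
Unset Strict Implicit.
Import Order.TTheory GRing.Theory Num.Theory.
Import numFieldNormedType.Exports.
Local Open Scope classical_set_scope.
Local Open Scope ring_scope.

(* Let U_m be the part of the sine curve to the left of its m-th minimum; it
   is open in W because the arc stays away from the sine curve.  A path whose
   height varies by less than 2 cannot jump from U_(m+1) out of U_m.  A compact
   set of paths is equicontinuous, so for some N all its paths that start in
   U_(m+N) end in U_m, and conversely.  Hence if nu is the boundary of mu, the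
   sets of paths entering or leaving U_(N m), for varying m, are pairwise
   disjoint on the carrier of mu, and by countable additivity the series of the
   nu (U_(N m)) converges.
   For 0 < a < 1 put an atom on the maximum between the n-th and (n+1)-st
   minima so that the total mass of U_m is (m+1)^-a.  In a nontrivial linear
   combination the smallest exponent dominates, so the series above diverges
   like a harmonic series: the classes of these chains are independent. *)

(** * Finite signed Borel measures and countable additivity *)

Section SignedMeasure.
Variables (R : realType) (T : topologicalType).
Implicit Types (A B : set T) (mu : set T -> R).

Lemma borel_open A : open A -> borel T A.
Proof. by move=> oA; exact: sub_gen_smallest. Qed.

Lemma borel0 : borel T set0.
Proof. exact: sigma_algebra0. Qed.

Lemma borelC A : borel T A -> borel T (~` A).
Proof. by move=> bA; rewrite -setTD; exact: sigma_algebraCD. Qed.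

Lemma borelI A B : borel T A -> borel T B -> borel T (A `&` B).
Proof.
move=> bA bB; rewrite -[A `&` B]setCK setCI -bigcup2E; apply: borelC.
by apply: sigma_algebra_bigcup => -[|[|n]]/=; [exact: borelC..|exact: borel0].
Qed.

Lemma borelD A B : borel T A -> borel T B -> borel T (A `\` B).
Proof. by move=> bA bB; rewrite setDE; apply: borelI => //; exact: borelC. Qed.

Lemma signed_measureU mu A B : signed_borel_measure R T mu ->
  borel T A -> borel T B -> A `&` B = set0 -> mu (A `|` B) = mu A + mu B.
Proof.
move=> [mu0 muS] bA bB AB0.
have := muS (bigcup2 A B); rewrite bigcup2E => /(_ _ _)/cvg_lim H.
rewrite -H //; last first.
- by rewrite -trivIset_bigcup2.
- by move=> [|[|n]]//=; exact: borel0.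
apply: lim_near_cst => //; near=> n.
have /subnK <- : (2 <= n)%N by near: n; exists 2%N.
rewrite addn2 2!big_ord_recl big1 ?addr0//= => i _.
Unshelve. all: by end_near. Qed.

Lemma signed_measureD mu A B : signed_borel_measure R T mu ->
  borel T A -> borel T B -> mu A - mu B = mu (A `\` B) - mu (B `\` A).
Proof.
move=> smu bA bB.
have split_measure X Y : borel T X -> borel T Y ->
    mu X = mu (X `\` Y) + mu (X `&` Y).
  move=> bX bY.
  have E0 : (X `\` Y) `&` (X `&` Y) = set0.
    by rewrite -subset0 => x [[_ nY] [_ Yx]].
  rewrite -signed_measureU//; [|exact: borelD|exact: borelI].
  by rewrite setUC setUIDK.
rewrite (split_measure A B)// (split_measure B A)// (setIC B A).
by rewrite opprD addrACA subrr addr0.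
Qed.

(* Up to a set missing the carrier, the [A m `\` B m] are pairwise disjoint,
   so countable additivity makes the series of their measures converge. *)
Lemma is_cvg_series_interlaced mu (A B : nat -> set T) (K : set T) :
    signed_borel_measure R T mu ->
    (forall X, borel T X -> X `<=` ~` K -> mu X = 0) ->
    (forall m, borel T (A m)) -> (forall m, borel T (B m)) ->
    (forall m, A m.+1 `<=` A m) ->
    (forall m, K `&` A m.+1 `<=` B m) ->
  cvgn (series (fun m => mu (A m `\` B m))).
Proof.
move=> smu muK bA bB dA AB.
have dAn m n : (m <= n)%N -> A n `<=` A m.
  by move=> /subnK <-; elim: (n - m)%N => [//|k IH] x /dA /IH.
(* On the carrier [A m.+1] lies in [B m], so removing it here does not change the measure, while it
   makes the sets [E m] disjoint. *)
pose E m := (A m `\` B m) `\` A m.+1.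
have bE m : borel T (E m) by apply: borelD => //; exact: borelD.
have muE m : mu (A m `\` B m) = mu (E m).
  have bAB : borel T ((A m `\` B m) `&` A m.+1).
    by apply: borelI => //; exact: borelD.
  have E0 : (A m `\` B m) `&` A m.+1 `&` E m = set0.
    by rewrite -subset0 => x [[_ Ax] [_ nAx]].
  have {1}-> : A m `\` B m = (A m `\` B m) `&` A m.+1 `|` E m.
    by rewrite setUIDK.
  rewrite signed_measureU// muK ?add0r// => x [[Ax nBx] Ax1] Kx.
  by apply: nBx; exact: AB.
have -> : series (fun m => mu (A m `\` B m)) = (fun n => \sum_(m < n) mu (E m)).
  apply/funext => n; rewrite /series/= big_mkord.
  by apply: eq_bigr => i _; rewrite muE.
case: smu => _ /(_ E bE) H; apply/cvg_ex; exists (mu (\bigcup_n E n)); apply: H.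
apply/trivIsetP => i j _ _; wlog ij : i j / (i < j)%N => [H|_].
  rewrite neq_ltn => /orP[ij|ji]; first by apply: H => //; rewrite ltn_eqF.
  by rewrite setIC; apply: H => //; rewrite ltn_eqF.
rewrite -subset0 => x [[_ nAx] [[Ajx _] _]]; apply: nAx; exact: dAn ij _ Ajx.
Qed.

(** If [A m] and [B m] consist of the paths that end, respectively start, in a level, then the two
    set differences hold the paths entering and the paths leaving it. Interlacing treats each of
    them separately. *)
Lemma is_cvg_series_signed_measureB mu (A B : nat -> set T) (K : set T) :
    signed_borel_measure R T mu ->
    (forall X, borel T X -> X `<=` ~` K -> mu X = 0) ->
    (forall m, borel T (A m)) -> (forall m, borel T (B m)) ->
    (forall m, A m.+1 `<=` A m) -> (forall m, B m.+1 `<=` B m) ->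
    (forall m, K `&` A m.+1 `<=` B m) -> (forall m, K `&` B m.+1 `<=` A m) ->
  cvgn (series (fun m => mu (A m) - mu (B m))).
Proof.
move=> smu muK bA bB dA dB AB BA.
have := @is_cvg_series_interlaced mu A B K smu muK bA bB dA AB.
have := @is_cvg_series_interlaced mu B A K smu muK bB bA dB BA.
move=> cB cA.
rewrite (_ : (fun _ => _) =
    (fun m => mu (A m `\` B m)) - (fun m => mu (B m `\` A m))).
  exact: is_cvg_seriesB.
by apply/funext => m; rewrite signed_measureD.
Qed.

End SignedMeasure.

(** * Simplices of dimension 0 and 1 *)

Section Simplices.
Variable R : realType.

Lemma vertex_subproof : std_simplex R 0 (const_mx 1).
Proof. by split => [j|]; [rewrite mxE|rewrite big_ord1 mxE]. Qed.

Definition vertex : Simplex R 0 := SigSub (mem_set vertex_subproof).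

Lemma Simplex0_eq (x : Simplex R 0) : x = vertex.
Proof.
apply: val_inj => /=; have [_] := set_valP x.
rewrite big_ord1 => x1; apply/rowP => j; rewrite ord1 mxE -x1.
by [].
Qed.

Definition clamp (t : R) : R := Num.min (Num.max t 0) 1.

Lemma clamp_itv t : 0 <= clamp t <= 1.
Proof. by rewrite /clamp le_min le_max ge_min !lexx ler01 !orbT. Qed.

Lemma clamp_id t : 0 <= t <= 1 -> clamp t = t.
Proof. by case/andP => t0 t1; rewrite /clamp max_l// min_l. Qed.

Lemma continuous_clamp : continuous clamp.
Proof.
have cmax : continuous (id \max cst 0 : R -> R^o).
  by move=> t; apply: continuous_max => //; exact: cst_continuous.
have : continuous ((id \max cst 0) \min cst 1 : R -> R^o).
  by move=> t; apply: continuous_min; [exact: cmax|exact: cst_continuous].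
by [].
Qed.

Definition edge_row (t : R) : 'rV[R]_2 :=
  \row_j if j == ord0 then 1 - clamp t else clamp t.

Lemma edge_subproof t : std_simplex R 1 (edge_row t).
Proof.
have /andP[t0 t1] := clamp_itv t.
split => [j|]; first by rewrite mxE; case: ifP; rewrite // subr_ge0.
by rewrite big_ord_recl big_ord1 !mxE/= subrK.
Qed.

(* Defined on the whole line so that singular 1-simplices become paths
   [R -> X], with no subspace topology on the domain. *)
Definition edge (t : R) : Simplex R 1 := SigSub (mem_set (edge_subproof t)).

Lemma continuous_edge : continuous edge.
Proof.
have ce i j : continuous (fun u => edge_row u i j).
  have -> : (fun u => edge_row u i j) =
      if j == ord0 then fun u => 1 - clamp u else clamp.
    by apply/funext => u; rewrite mxE; case: ifP.
  case: ifP => _; last exact: continuous_clamp.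
  move=> t; apply: (@cvgB R R^o); first exact: cvg_cst.
  exact: continuous_clamp.
apply: (@continuous_comp_initial (Simplex R 1) R 'rV[R]_2 set_val edge).
move=> t A [P MP sPA].
apply: (@filterS _ _ _ [set u | forall i j, P i j (edge_row u i j)]).
  by move=> u Pu; exact: sPA.
apply: (@filter_forall _ _ (fun i u => forall j, P i j (edge_row u i j))
  (nbhs t)) => i.
apply: (@filter_forall _ _ (fun j u => P i j (edge_row u i j)) (nbhs t)) => j.
exact: (ce i j t _ (MP i j)).
Qed.

(** The face opposite vertex 0 is the endpoint with parameter 1, and conversely; the boolean
    [i == ord0] performs this swap. *)
Lemma face_map_vertex (i : 'I_2) :
  face_map R 0 i (set_val vertex) = set_val (edge (i == ord0)%:R).
Proof.
apply/rowP => j; rewrite !mxE.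
rewrite clamp_id; last by rewrite ler0n lern1 leq_b1.
case: unliftP => [j' ->|->]; last by case: eqP; rewrite ?subr0 ?subrr.
have -> : (lift i j' == ord0) = (i != ord0).
  by rewrite -!val_eqE /= ord1; case: i {j'} => [[|[]]].
by rewrite mxE; case: eqP; rewrite ?subr0.
Qed.

End Simplices.

(** * Evaluation, constant simplices and faces in the compact-open topology *)

Section SingTopology.
Variables (R : realType) (X : topologicalType).

Definition ev {k} (x : Simplex R k) (s : Sing R X k) : X :=
  (set_val s : Simplex R k -> X) x.

Lemma continuous_Sing k (s : Sing R X k) : continuous (ev ^~ s).
Proof. exact: (set_valP s). Qed.

Lemma open_Sing_image k (K : set (Simplex R k)) (O : set X) :
  compact K -> open O -> open [set s : Sing R X k | ev ^~ s @` K `<=` O].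
Proof.
move=> cK oO.
exists [set g : {compact-open, Simplex R k -> X} | g @` K `<=` O] => //.
exact: compact_open_open.
Qed.

Lemma open_Sing_ev k (x : Simplex R k) (O : set X) :
  open O -> open [set s : Sing R X k | O (ev x s)].
Proof.
move=> oO; rewrite (_ : mkset _ =
    [set s : Sing R X k | ev ^~ s @` [set x] `<=` O]).
  by apply: open_Sing_image => //; exact: compact_set1.
by apply/seteqP; split => s /= => [Os _ [_ -> <-]//|]; apply; exists x.
Qed.

Lemma cst_sing_subproof (p : X) :
  [set f : {compact-open, Simplex R 0 -> X} | continuous f] (fun=> p).
Proof. exact: cst_continuous. Qed.

Definition cst_sing (p : X) : Sing R X 0 :=
  SigSub (mem_set (@cst_sing_subproof p)).

Lemma continuous_cst_sing : continuous cst_sing.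
Proof.
apply: (@continuous_comp_initial (Sing R X 0) X
  {compact-open, Simplex R 0 -> X} set_val cst_sing) => p.
apply/compact_open_cvgP => K O cK oO /= KO.
(* An empty [K] offers no point from which to extract [O p], but its image condition is vacuous. *)
have [->|/set0P[x Kx]] := eqVneq K set0.
  by apply: nearW => q y [].
have : O p by apply: KO; exists x.
move: oO; rewrite openE => /[apply]; apply: filterS => q Oq _ [y Ky <-].
exact: Oq.
Qed.

(** Since [is_face] is a relation, a face has to be exhibited; in dimension 0 the constant simplex
    at the endpoint is one. *)
Lemma face_preimage (i : 'I_2) (U : set X) :
  [set s : Sing R X 1 | exists tau,
     is_face R X 0 i s tau /\ U (ev (vertex R) tau)] =
  [set s | U (ev (edge (i == ord0)%:R) s)].
Proof.
apply/seteqP; split => s /=.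
  move=> [tau [stau]]; rewrite /ev (stau _ (edge (i == ord0)%:R))//.
  by rewrite face_map_vertex.
move=> Us.
exists (cst_sing (ev (edge (i == ord0)%:R) s)); split => // x y.
rewrite (Simplex0_eq x) face_map_vertex => /val_inj ->.
by [].
Qed.

Lemma mt_boundary0E (mu : set (Sing R X 1) -> R) (U : set X) :
  mt_boundary R X 0 mu [set tau | U (ev (vertex R) tau)] =
  mu [set s | U (ev (edge 1) s)] - mu [set s | U (ev (edge 0) s)].
Proof.
rewrite /mt_boundary 2!big_ord_recl big_ord0 addr0 expr0 mul1r expr1 mulN1r.
by rewrite /face_op !face_preimage.
Qed.

End SingTopology.

(** * Compact families of paths and convergence for boundaries *)

Lemma uniform_continuity_itv01 (R : realType) (f : R -> R) (e : R) :
  continuous f -> 0 < e -> exists n : nat,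
  forall t s, 0 <= t <= 1 -> `|s - t| <= n.+1%:R^-1 -> `|f s - f t| < e.
Proof.
move=> cf e0.
have /compact_near_coveringP/(_ nat \oo (fun n t => forall s,
    `|s - t| <= n.+1%:R^-1 -> `|f s - f t| < e)) := @segment_compact R 0 1.
have FF : Filter \oo by exact: eventually_filter.
case/(_ FF) => [t _|n _ /(_ n (leqnn _)) H]; last first.
  by exists n => t s t01 st; apply: H => //=; rewrite in_itv.
have e2 : 0 < e / 2 by rewrite divr_gt0.
have /cvgrPdist_lt/(_ _ e2)/nbhs_ballP[d /= d0 fd] := cf t.
(* One half of [d] is spent on moving from [t] to [u], the other on moving from [u] to [s]. *)
have d2 : 0 < d / 2 by rewrite divr_gt0.
have H1 : \forall u \near t, `|t - u| < d / 2.
  by apply/nbhs_ballP; exists (d / 2).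
have H2 : \forall n \near \oo, n.+1%:R^-1 < d / 2.
  have /cvgrPdist_lt/(_ _ d2) := @cvg_harmonic R.
  by apply: filterS => n; rewrite /= sub0r normrN ger0_norm.
exists ([set u | `|t - u| < d / 2], [set n | n.+1%:R^-1 < d / 2]) => //.
move=> [u n] [/= tu nd] s su.
have : `|f t - f u| < e / 2.
  apply: fd; apply: lt_trans tu _.
  lra.
have : `|f t - f s| < e / 2.
  apply: fd; rewrite /ball/= -[t - s](subrKA u) (le_lt_trans (ler_normD _ _))//.
  rewrite (distrC u s).
  by rewrite (splitr d) ltrD// (le_lt_trans su).
move=> fts ftu; rewrite -(subrKA (f t)) (le_lt_trans (ler_normD _ _))//.
by rewrite (splitr e) ltrD// distrC.
Qed.

Section BoundaryLevels.
Variables (R : realType) (X : topologicalType).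
Variables (U : nat -> set X) (Y : X -> R).
Hypotheses (oU : forall m, open (U m)) (dU : forall m, U m.+1 `<=` U m).
Hypothesis cY : continuous Y.
Hypothesis osc_level : forall (p : R -> X) m, continuous p ->
  (forall s t, 0 <= s <= 1 -> 0 <= t <= 1 -> `|Y (p s) - Y (p t)| < 2) ->
  U m.+1 (p 0) -> U m (p 1).

(** The loss [N] is the same for all [m]; this uniformity is what lets one [N] serve the whole
    sequence of levels. *)
Let near_levels (N : nat) (s : Sing R X 1) := forall m,
  (U (m + N)%N (ev (edge 1) s) -> U m (ev (edge 0) s)) /\
  (U (m + N)%N (ev (edge 0) s) -> U m (ev (edge 1) s)).

Let dUn m n : (m <= n)%N -> U n `<=` U m.
Proof.
by move=> /subnK <-; elim: (n - m)%N => [//|k IH] x /dU /IH.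
Qed.

Let continuous_path (s : Sing R X 1) : continuous (fun t => ev (edge t) s).
Proof.
move=> t; apply: (continuous_comp (@continuous_edge R t)).
exact: (@continuous_Sing _ _ _ s).
Qed.

(** Uniform continuity cuts [s] into [n.+1] pieces on which [Y] stays within 1 of its initial value.
    This is an open condition on the path, so it persists nearby, and each piece costs at most one
    level. *)
Lemma near_levels_local (s : Sing R X 1) :
  exists N, \forall s' \near s, near_levels N s'.
Proof.
have cf : continuous (fun t => Y (ev (edge t) s)).
  by move=> t; apply: (continuous_comp (@continuous_path s t)); exact: cY.
have [n fn] := uniform_continuity_itv01 cf ltr01.
pose h : R := n.+1%:R^-1.
have h0 : 0 < h by rewrite invr_gt0 ltr0n.
have nh : n.+1%:R * h = 1 by rewrite divff.
exists n.+1.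
pose t (j : nat) := j%:R * h.
pose K j : set (Simplex R 1) := @edge R @` `[t j, t j.+1].
pose O j := [set x : X | `|Y x - Y (ev (edge (t j)) s)| < 1].
have cK j : compact (K j).
  apply: continuous_compact; last exact: segment_compact.
  exact/continuous_subspaceT/continuous_edge.
have oO j : open (O j).
  rewrite (_ : O j = Y @^-1` (ball (Y (ev (edge (t j)) s)) 1)).
    by move/continuousP : cY; apply; exact: ball_open.
  by apply/seteqP; split => x; rewrite /O /ball/= distrC.
have tS j : t j.+1 = t j + h by rewrite /t -natr1 mulrDl mul1r.
have t01 (j : 'I_n.+2) : 0 <= t j <= 1.
  rewrite /t mulr_ge0 ?ler0n ?(ltW h0)//= -[leRHS]nh ler_pM2r// ler_nat.
  by rewrite -ltnS.
have : \forall s' \near s, forall j : 'I_n.+1, @ev R X 1 ^~ s' @` K j `<=` O j.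
  apply: (@filter_forall _ _
    (fun (j : 'I_n.+1) s' => @ev R X 1 ^~ s' @` K j `<=` O j) (nbhs s)).
  move=> j; apply: open_nbhs_nbhs; split; first exact: open_Sing_image.
  move=> _ [_ [u /= tu <-] <-]; apply: fn.
    exact: (t01 (widen_ord (leqnSn _) j)).
  move: tu; rewrite in_itv/= tS => /andP[tu ut].
  by rewrite ger0_norm ?subr_ge0// lerBlDl.
apply: filterS => s' s'O.
(* Both values lie within 1 of the same centre, whence the bound 2 required by [osc_level]. *)
have osc (j : 'I_n.+1) u v : t j <= u <= t j.+1 -> t j <= v <= t j.+1 ->
    `|Y (ev (edge u) s') - Y (ev (edge v) s')| < 2.
  have Ou w : t j <= w <= t j.+1 -> O j (ev (edge w) s').
    by move=> tw; apply: (s'O j); exists (edge w) => //; exists w.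
  move=> /Ou Hu /Ou; move: Hu; rewrite /O /= !ltr_norml.
  by move=> /andP[? ?] /andP[? ?]; apply/andP; split; lra.
have step (j : 'I_n.+1) m :
    (U m.+1 (ev (edge (t j)) s') -> U m (ev (edge (t j.+1)) s')) /\
    (U m.+1 (ev (edge (t j.+1)) s') -> U m (ev (edge (t j)) s')).
  have affine (a b : R) : continuous (fun u : R => a + u * b : R).
    have : continuous (cst a + (fun u : R => u * b : R^o)).
      move=> u; apply: continuousD; first exact: cst_continuous.
      by apply: continuousM; [exact: cvg_id|exact: cst_continuous].
    by [].
  have path_affine (a b : R) :
      continuous (fun u : R => ev (edge (a + u * b)) s').
    move=> u; apply: (@continuous_comp _ _ _ (fun u : R => a + u * b : R)
      (fun t => ev (edge t) s')); [exact: affine|exact: continuous_path].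
  have hb u : 0 <= u <= 1 -> 0 <= u * h <= h.
    by move=> /andP[u0 u1]; have hge := ltW h0; rewrite mulr_ge0//= ler_piMl.
  split.
    move=> H; have := @osc_level _ m (path_affine (t j) h).
    rewrite mul0r addr0 mul1r -tS; apply => // u v /hb uh /hb vh.
    by apply: (osc j); rewrite tS; lra.
  (* The same piece run backwards: negative slope, starting from its right end. *)
  move=> H; have := @osc_level _ m (path_affine (t j.+1) (- h)).
  rewrite mul0r addr0 mul1r tS addrK -tS; apply => // u v /hb uh /hb vh.
  by apply: (osc j); rewrite tS !mulrN; lra.
have fwd j : (j <= n.+1)%N -> forall m,
    U (m + j)%N (ev (edge (t 0)) s') -> U m (ev (edge (t j)) s').
  elim: j => [_ m|j IH jn m]; first by rewrite addn0.
  rewrite addnS -addSn => /(IH (ltnW jn)) H.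
  by have [+ _] := step (Ordinal jn) m; apply.
have bwd j : (j <= n.+1)%N -> forall m,
    U (m + j)%N (ev (edge (t j)) s') -> U m (ev (edge (t 0)) s').
  elim: j => [_ m|j IH jn m]; first by rewrite addn0.
  rewrite addnS => H; apply: (IH (ltnW jn)).
  by have [_] := step (Ordinal jn) (m + j)%N; apply.
move=> m; have := bwd n.+1 (leqnn _) m; have := fwd n.+1 (leqnn _) m.
by rewrite /t mul0r nh; split.
Qed.

(** Compactness of the carrier turns the local losses into a single [N]. Levels taken [N] apart then
    satisfy the interlacing inclusions for both endpoints. *)
Lemma is_cvg_series_mt_boundary (mu : set (Sing R X 1) -> R) :
  mt_chain R X 1 mu -> exists N, (0 < N)%N /\
    cvgn (series (fun m => mt_boundary R X 0 mu
                             [set tau | U (N * m)%N (ev (vertex R) tau)])).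
Proof.
move=> [smu [K [cK muK]]].
have near_levelsS N N' s : (N <= N')%N -> near_levels N s -> near_levels N' s.
  move=> NN' Hs m; have [H1 H2] := Hs m.
  have UU : U (m + N')%N `<=` U (m + N)%N by apply: dUn; rewrite leq_add2l.
  by split=> /UU; [exact: H1|exact: H2].
have [N N0 KN] : exists2 N, (0 < N)%N & K `<=` near_levels N.
  have FF : Filter \oo by exact: eventually_filter.
  move/compact_near_coveringP : cK => /(_ nat \oo near_levels FF) [s _|N _ KN].
    have [N HN] := near_levels_local s.
    exists ([set s' | near_levels N s'], [set n | (N <= n)%N]).
      by split => //; exists N.
    by move=> [s' n] /= [Hs' Nn]; exact: near_levelsS Hs'.
  (* The successor keeps the spacing positive; with spacing 0 all the levels [U (N * m)] would
     coincide. *)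
  by exists N.+1 => //; apply: KN => /=.
exists N; split => //.
under eq_fun do rewrite mt_boundary0E.
apply: (@is_cvg_series_signed_measureB _ _ _ _ _ K) => // m.
- by apply: borel_open; exact: open_Sing_ev.
- by apply: borel_open; exact: open_Sing_ev.
- by move=> s /=; apply: dUn; rewrite leq_mul.
- by move=> s /=; apply: dUn; rewrite leq_mul.
- by move=> s [/KN /(_ (N * m)%N) [+ _]]; rewrite mulnS addnC; exact.
- by move=> s [/KN /(_ (N * m)%N) [_ +]]; rewrite mulnS addnC; exact.
Qed.

End BoundaryLevels.

(** * Divergence of combinations of powers of the harmonic sequence *)

Lemma is_cvg_series_shift (R : realType) (u : nat -> R) (M : nat) :
  cvgn (series (fun n => u (n + M)%N)) <-> cvgn (series u).
Proof.
rewrite -(is_cvg_series_restrict M u).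
have -> : series (fun n => u (n + M)%N) = fun n => \sum_(M <= k < n + M) u k.
  by apply/funext => n; rewrite /series/= -{2}[M]add0n big_addn addnK.
set v := fun n => \sum_(M <= k < n) u k.
by split => /cvg_ex[l vl]; apply/cvg_ex; exists l; move: vl;
  rewrite (@cvg_shiftn M _ v).
Qed.

Lemma harmonic_powR_cvg0 (R : realType) (N : nat) (a : R) :
  (0 < N)%N -> 0 < a ->
  harmonic (N * m)%N `^ a @[m --> \oo] --> 0.
Proof.
move=> N0 a0; move/cvg_at_rightP : (powR_cvg0 a0); apply; split => [m|].
  exact: harmonic_gt0.
apply: (@squeeze_cvgr _ _ _ _ (fun=> 0) harmonic); last 2 first.
- exact: cvg_cst.
- exact: cvg_harmonic.
apply: nearW => m; rewrite harmonic_ge0/= lef_pV2 ?posrE ?ltr0n//.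
by rewrite ler_nat ltnS leq_pmull.
Qed.

(** After division by the power with the smallest exponent among the nonzero coefficients, the other
    terms tend to 0. As that exponent is below 1, a multiple of the sum eventually dominates the
    harmonic sequence. *)
Lemma dvg_series_harmonic_powR (R : realType) (N n : nat) (a c : 'I_n -> R) :
    (0 < N)%N -> injective a -> (forall j, 0 < a j < 1) ->
    (exists j, c j != 0) ->
  ~ cvgn (series (fun m => \sum_(j < n) c j * harmonic (N * m)%N `^ a j)).
Proof.
move=> N0 inja a01 [j cj].
case: (@arg_minP _ _ _ j (fun j => c j != 0) a cj) => {cj}j cj0 minj.
set d := fun m => _ => cvd.
have h0 m : 0 < @harmonic R (N * m)%N by exact: harmonic_gt0.
have lim_d : d m / harmonic (N * m)%N `^ a j @[m --> \oo] --> c j.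
  have -> : c j = \sum_i c i * (i == j)%:R.
    rewrite (bigD1 j)//= eqxx mulr1 big1 ?addr0// => i /negbTE ->.
    by rewrite mulr0.
  rewrite (_ : (fun _ => _) = (fun m =>
    \sum_i c i * harmonic (N * m)%N `^ (a i - a j))); last first.
    apply/funext => m; rewrite mulr_suml; apply: eq_bigr => i _.
    rewrite -mulrA -powRB; last by rewrite (gt_eqF (h0 m)) implybT.
    by [].
  apply: cvg_big => //= [|i _]; first exact: add_continuous.
  have [->|ci] := eqVneq (c i) 0.
    rewrite mul0r; apply: cvg_near_cst; apply: nearW => m; rewrite mul0r.
    by [].
  apply: cvgM; first exact: cvg_cst.
  have [->|ij] := eqVneq i j.
    by apply: cvg_near_cst; apply: nearW => m; rewrite subrr powRr0.
  apply: harmonic_powR_cvg0 => //; rewrite subr_gt0 lt_neqAle minj// andbT.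
  by apply: contra_neq ij => /inja.
have [M _ dM] : \forall m \near \oo,
    `|c j - d m / harmonic (N * m)%N `^ a j| < `|c j| / 2.
  by move/cvgrPdist_lt : lim_d; apply; rewrite divr_gt0// normr_gt0.
have cj_gt0 : 0 < `|c j| by rewrite normr_gt0.
(* Dividing by [c j] absorbs its sign, 2 makes up for the lower bound 1/2 on [q / c j], and [N] pays
   for the subsampling: 1/(m+1) <= N/(Nm+1). *)
pose k := 2 * N%:R / c j.
have N0R : 0 < N%:R :> R by rewrite ltr0n.
have kd m : (M <= m)%N -> harmonic m <= k * d m.
  move=> /dM; set q := d m / _ => /= cq.
  have qc : 2^-1 <= q / c j.
    have -> : q / c j = 1 - (c j - q) / c j by field.
    have : `|(c j - q) / c j| < 2^-1.
      by rewrite normrM normfV ltr_pdivrMr// mulrC.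
    by rewrite ltr_norml => /andP[_ ?]; lra.
  have -> : k * d m = 2 * N%:R * (harmonic (N * m)%N `^ a j * (q / c j)).
    rewrite /k /q; field; rewrite cj0 /=.
    by rewrite gt_eqF// powR_gt0.
  have hN : @harmonic R m <= N%:R * harmonic (N * m)%N.
    rewrite /= ler_pdivlMr ?ltr0n// mulrC ler_pdivrMr ?ltr0n//.
    by rewrite -natrM ler_nat mulnS -add1n leq_add2r.
  have ha : @harmonic R (N * m)%N <= harmonic (N * m)%N `^ a j.
    have /andP[a0 a1] := a01 j.
    apply: ger1_powR; last exact: ltW.
    by rewrite h0/= invf_le1 ?ltr0n// ler1n.
  apply: (le_trans hN); rewrite -mulrA mulrCA ler_pM2l//.
  have := ler_pM (ltW (h0 m)) _ ha qc; rewrite invr_ge0 ler0n => /(_ isT).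
  lra.
apply: (@dvg_harmonic R); apply/(@is_cvg_series_shift _ _ M).
apply: (series_le_cvg (v_ := fun n => k * d (n + M)%N)) => [p|p|p|].
- exact: harmonic_ge0.
- by apply: le_trans (kd _ (leq_addl _ _)); exact: harmonic_ge0.
- by apply: kd; exact: leq_addl.
- apply/(@is_cvg_series_shift _ (fun n => k * d n)).
  exact: (@is_cvg_seriesZ _ d k cvd).
Qed.

(** * Compact carriers and atomic measures *)

Lemma compact_cvg_range (T : topologicalType) (u : nat -> T) (l : T) :
  u @ \oo --> l -> compact (range u `|` [set l]).
Proof.
move=> ul; apply/compact_near_coveringP => I F P FF cover.
have Pu n : \forall i \near F, P i (u n).
  have run : (range u `|` [set l]) (u n) by left; exists n.
  have [[A B] [/= Aun FB] AB] := cover (u n) run.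
  apply: filterS FB => i Bi; apply: (AB (u n, i)); split => //.
  exact: nbhs_singleton.
have [[A B] [/= Al FB] AB] := cover l (or_intror erefl).
have [N _ uN] := ul _ Al.
have PN : \forall i \near F, forall n : 'I_N, P i (u n).
  by apply: (@filter_forall _ _ (fun (n : 'I_N) i => P i (u n)) F).
apply: filterS2 PN FB => i PN Bi _ [[n _ <-]|->]; last first.
  by apply: (AB (l, i)); split => //; exact: nbhs_singleton.
have [nN|Nn] := ltnP n N; first exact: (PN (Ordinal nN)).
by apply: (AB (u n, i)); split => //; exact: uN.
Qed.

(** Here [tau] prescribes the masses of tails: [x n] gets weight [tau n - tau n.+1], and these
    telescope because [tau] tends to 0. The measure is built on the discrete space [nat] and
    transported along [x], so it makes sense on every set. *)
Lemma exists_atomic_measure (R : realType) (T : topologicalType) (x : nat -> T)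
    (tau : nat -> R) :
  (forall n, tau n.+1 <= tau n) -> tau @ \oo --> 0 ->
  exists nu : set T -> R, [/\ signed_borel_measure R T nu,
    (forall A, (forall n, ~ A (x n)) -> nu A = 0) &
    (forall A m, (forall n, A (x n) <-> (m <= n)%N) -> nu A = tau m)].
Proof.
move=> dtau tau0.
have w0 n : 0 <= tau n - tau n.+1 by rewrite subr_ge0.
pose D (n : nat) : {measure set nat -> \bar R} := mscale (NngNum (w0 n)) \d_n.
pose P : {measure set nat -> \bar R} := mseries D 0.
have Ptail m (A : set nat) : (forall n, A n <-> (m <= n)%N) -> P A = (tau m)%:E.
  move=> Am; rewrite /P/= /mseries; apply/cvg_lim => //.
  rewrite -(cvg_shiftn m).
  rewrite (_ : (fun n => _) = fun n => (tau m - tau (n + m)%N)%:E).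
    apply: cvg_EFin; first exact: nearW.
    rewrite -[X in _ --> X]subr0; apply: cvgB; first exact: cvg_cst.
    by rewrite (cvg_shiftn m).
  apply/funext => n; rewrite (big_cat_nat (n := m))//= ?leq_addl//.
  rewrite big_nat big1 ?add0e => [|i /andP[_ im]]; last first.
    rewrite /mscale/= diracE memNset ?mule0// => /Am.
    by rewrite leqNgt im.
  under eq_big_nat => i /andP[mi _].
    rewrite /mscale/= diracE mem_set ?mule1; last exact/Am.
    over.
  rewrite sumEFin; congr EFin.
  rewrite (@telescope_sumr_eq _ _ _ (fun i => - tau i)) ?leq_addl//.
    by rewrite opprK addrC.
  by move=> k _; rewrite opprK addrC.
have Pfin A : P A \is a fin_num.
  rewrite ge0_fin_numE ?measure_ge0//.
  apply: (@le_lt_trans _ _ (P setT)).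
    by apply: le_measure => //; rewrite inE.
  by rewrite (Ptail 0%N)// ltry.
exists (fun A => fine (P (x @^-1` A))); split.
- split; first by rewrite preimage_set0 measure0.
  move=> F _ tF.
  rewrite (_ : (fun _ => _) = fine \o
      (fun n => (\sum_(0 <= m < n) P (x @^-1` F m))%E)).
    apply: fine_cvg; rewrite fineK// preimage_bigcup.
    apply: measure_sigma_additive => //.
    apply/trivIsetP => i j _ _ ij.
    by rewrite -preimage_setI (trivIsetP.1 tF i j)// preimage_set0.
  apply/funext => n /=; rewrite big_mkord.
  by rewrite sum_fine// => i _; exact: Pfin.
- move=> A Ax; rewrite (_ : _ @^-1` _ = set0) ?measure0//.
  by apply/seteqP; split => // n /Ax.
- by move=> A m Am; rewrite (Ptail m).
Qed.

(** * Phases of the minima and maxima of the sine curve *)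

Section Phases.
Variable R : realType.

(** The value of 1/x at the [m]-th minimum, counted from the right starting with 0; the next maximum
    to the left is at phase [trough m + pi]. *)
Definition trough (m : nat) : R := 3 * pi / 2 + m%:R * (pi *+ 2).

Lemma sin_trough m : sin (trough m) = -1.
Proof.
rewrite /trough; elim: m => [|m IH].
  rewrite mul0r addr0 (_ : 3 * pi / 2 = pi / 2 + pi); last by field.
  by rewrite sinDpi sin_pihalf.
rewrite (_ : _ + _ = 3 * pi / 2 + m%:R * (pi *+ 2) + pi *+ 2) ?sinD2pi//.
by rewrite -(natr1 m); ring.
Qed.

Lemma sin_crest m : sin (trough m + pi) = 1.
Proof. by rewrite sinDpi sin_trough opprK. Qed.

Lemma trough_gt m : m.+1%:R < trough m.
Proof.
have pi2 := pi_ge2 R; have m0 : 0 <= m%:R :> R by exact: ler0n.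
have mpi : m%:R * 2 <= m%:R * pi :> R by rewrite ler_wpM2l.
rewrite /trough -(natr1 m) -(mulr_natl pi 2); move: pi2 m0 mpi.
move: (m%:R : R) (pi : R) => x y y2 x0 xy.
nra.
Qed.

Lemma trough_gt0 m : 0 < trough m.
Proof. by apply: lt_trans (trough_gt m); rewrite ltr0n. Qed.

Lemma troughS m : trough m.+1 = trough m + pi + pi.
Proof. by rewrite /trough -(natr1 m); ring. Qed.

Lemma ler_trough m n : (trough m <= trough n) = (m <= n)%N.
Proof. have pi2 : 0 < pi *+ 2 :> R by rewrite pmulrn_lgt0// pi_gt0.
by rewrite lerD2l ler_pM2r// ler_nat. Qed.

Lemma wx0E : wx0 R = (trough 0)^-1.
Proof.
by rewrite /wx0 /trough mul0r addr0 invf_div.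
Qed.

End Phases.

(** * Paths of small oscillation on the sine curve *)

Section Crossing.
Variables (R : realType) (X Y : R -> R) (m : nat).
Hypotheses (cX : continuous X) (cY : continuous Y).
Hypothesis osc : forall s t, 0 <= s <= 1 -> 0 <= t <= 1 -> `|Y s - Y t| < 2.

Lemma left_limit_closed (f : R -> R) (u : R) (D : set R) :
  {for u, continuous f} -> 0 < u -> closed D ->
  (forall t, 0 <= t < u -> D (f t)) -> D (f u).
Proof.
move=> cf u0 cD fD.
apply: (@closed_cvg _ _ (u^'-) _ f D cD); last exact: cvg_at_left_filter.
near=> t; apply: fD; apply/andP; split; last by near: t; exact: nbhs_left_lt.
by near: t; apply: nbhs_left_ge.
Unshelve. all: by end_near. Qed.

(** If the abscissa takes both values [a^-1] and [b^-1], the height takes both 1 and -1, and the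
    oscillation reaches 2. *)
Lemma no_crest_to_trough (t a b : R) :
  0 <= t <= 1 -> (forall s, 0 <= s <= t -> Y s = sin (X s)^-1) ->
  sin a = 1 -> sin b = -1 ->
  Num.min (X 0) (X t) <= a^-1 <= Num.max (X 0) (X t) ->
  Num.min (X 0) (X t) <= b^-1 <= Num.max (X 0) (X t) -> False.
Proof.
move=> /andP[t0 t1] YX sa sb Xa Xb.
have cXt : {within `[0, t], continuous X} by exact: continuous_subspaceT.
have [c] := IVT t0 cXt Xa; rewrite in_itv/= => /andP[c0 ct] Xc.
have [d] := IVT t0 cXt Xb; rewrite in_itv/= => /andP[d0 dt] Xd.
have := @osc c d; rewrite c0 d0 !(le_trans _ t1)//= => /(_ isT isT).
rewrite !YX ?c0 ?d0// Xc Xd !invrK sa sb opprK ger0_norm; last by lra.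
by rewrite ltxx.
Qed.

Hypothesis X0 : 0 < X 0 < (trough R m.+1)^-1.

(* By the intermediate value theorem a short path cannot run over both a crest
   and a trough, so it stays between the crest preceding [trough m.+1] and some
   crest beyond its starting point; in particular it cannot escape to the limit
   segment. *)
Lemma sine_curve_trapped (u : R) : 0 < u <= 1 ->
  (forall t, 0 <= t < u -> 0 < X t /\ Y t = sin (X t)^-1) ->
  0 < X u < (trough R m)^-1 /\ Y u = sin (X u)^-1.
Proof.
move=> /andP[u0 u1] sineX; have pi0 := pi_gt0 R.
have /andP[X00 X0m] := X0.
(* Some trough lies to the left of the starting point; the crest just beyond it gives the lower
   barrier [lo]. *)
set k := Num.bound (X 0)^-1.
have kX : (X 0)^-1 < trough R k.
  apply: lt_trans (trough_gt R k); rewrite -natr1 ltr_wpDr//.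
  by rewrite /k; apply: archi_boundP; rewrite invr_ge0 ltW.
have tk := trough_gt0 R k; have tm := trough_gt0 R m.
have tm1 := trough_gt0 R m.+1.
have tkp := addr_gt0 tk pi0; have tmp := addr_gt0 tm pi0.
pose lo := (trough R k + pi)^-1; pose hi := (trough R m + pi)^-1.
have Xt t : 0 <= t < u -> lo <= X t <= hi.
  move=> /andP[t0 tu]; have [Xt0 YXt] := sineX t (introT andP (conj t0 tu)).
  have t01 : 0 <= t <= 1 by rewrite t0 (le_trans (ltW tu)).
  have YX s : 0 <= s <= t -> Y s = sin (X s)^-1.
    move=> /andP[s0 st]; apply: (proj2 (sineX s _)).
    by rewrite s0 (le_lt_trans st).
  have hm1 : (trough R m.+1)^-1 <= hi.
    by rewrite lef_pV2 ?posrE// troughS lerDl ltW.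
  have lok : lo <= (trough R k)^-1.
    by rewrite lef_pV2 ?posrE// lerDl ltW.
  have k0 : (trough R k)^-1 <= X 0.
    by rewrite -[leRHS]invrK lef_pV2 ?posrE ?invr_gt0// ltW.
  (* Going below [lo] would pass trough [k] and the crest after it; going above [hi] would pass
     trough [m.+1] and the crest before it. *)
  apply/andP; split; rewrite leNgt; apply/negP => Xbad.
    apply: (no_crest_to_trough t01 YX (sin_crest R k) (sin_trough R k));
      rewrite -/lo ge_min le_max; apply/andP; split; apply/orP.
    - by right; exact: ltW.
    - by left; exact: le_trans k0.
    - by right; exact: ltW (lt_le_trans Xbad lok).
    - by left.
  apply: (no_crest_to_trough t01 YX (sin_crest R m) (sin_trough R m.+1));
    rewrite -/hi ge_min le_max; apply/andP; split; apply/orP.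
  - by left; exact: le_trans (ltW X0m) hm1.
  - by right; exact: ltW.
  - by left; exact: ltW.
  - by right; exact: le_trans hm1 (ltW Xbad).
(* The weak bounds survive the limit at [u]; since 0 < [lo] and [hi] < [(trough R m)^-1], they still
   yield the strict ones. *)
have Xu_lo : lo <= X u.
  apply: (@left_limit_closed X u [set x | lo <= x]) => //.
  - exact: cX.
  - by move=> t /Xt /andP[].
have Xu_hi : X u <= hi.
  apply: (@left_limit_closed X u [set x | x <= hi]) => //.
  - exact: cX.
  - by move=> t /Xt /andP[].
have lo0 : 0 < lo by rewrite invr_gt0.
have Xu0 : 0 < X u by exact: lt_le_trans Xu_lo.
split.
  by rewrite Xu0 (le_lt_trans Xu_hi)// ltf_pV2 ?posrE// ltrDl.
apply: subr0_eq.
pose f t := Y t - sin (X t)^-1; rewrite -[LHS]/(f u).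
suff : [set x | x = 0] (f u) by [].
apply: (@left_limit_closed f).
- apply: (@cvgB R R^o); first exact: cY.
  apply: (@cvg_comp _ _ _ (fun t => (X t)^-1) sin); last exact: continuous_sin.
  by apply: cvgV; [rewrite gt_eqF|exact: cX].
- exact: u0.
- exact: closed_eq.
- by move=> t /sineX[_ tY]; rewrite /f/= tY subrr.
Qed.

End Crossing.

(** * Levels and crests of the Warsaw circle *)

Section WarsawLevels.
Variables (R : realType) (g : R -> R * R).
Hypothesis arc : warsaw_arc R g.
Local Notation W := (Warsaw R g).

Definition xcoord (p : W) : R := (set_val p).1.
Definition ycoord (p : W) : R := (set_val p).2.

(* On [W], lying off the arc with positive abscissa amounts to lying on the sine
   curve; written this way, the set is visibly open. *)
Definition level (m : nat) : set W :=
  [set p | 0 < xcoord p < (trough R m)^-1 /\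
           ~ (g @` unit_interval R) (set_val p)].

Lemma continuous_xcoord : continuous xcoord.
Proof.
move=> p; apply: (@continuous_comp _ _ _ (set_val : W -> R * R) fst).
  exact: initial_continuous.
exact: cvg_fst.
Qed.

Lemma continuous_ycoord : continuous ycoord.
Proof.
move=> p; apply: (@continuous_comp _ _ _ (set_val : W -> R * R) snd).
  exact: initial_continuous.
exact: cvg_snd.
Qed.

Lemma open_level m : open (level m).
Proof.
have oarc : open (~` (g @` unit_interval R)).
  apply: closed_openC; apply: compact_closed; first exact: norm_hausdorff.
  have [cg _ _ _ _] := arc; move: cg.
  have -> : unit_interval R = `[0, 1]%classic.
    by apply/seteqP; split => t /=; rewrite in_itv.
  by move=> cg; apply: continuous_compact => //; exact: segment_compact.
rewrite (_ : level m = xcoord @^-1` `]0, (trough R m)^-1[%classic `&`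
    (set_val : W -> R * R) @^-1` (~` (g @` unit_interval R))).
  apply: openI.
    by move/continuousP : continuous_xcoord; apply; exact: itv_open.
  by exists (~` (g @` unit_interval R)).
by apply/seteqP; split => p /=; rewrite in_itv.
Qed.

Lemma level_sub m n : (m <= n)%N -> level n `<=` level m.
Proof.
move=> mn p [/andP[x0 xn] np]; split => //; rewrite x0 (lt_le_trans xn)//.
by rewrite lef_pV2 ?posrE ?trough_gt0// ler_trough.
Qed.

Lemma level_sine m p : level m p -> ycoord p = sin (xcoord p)^-1.
Proof.
move=> [/andP[x0 _] np]; have := set_valP p; rewrite /warsaw_circle /=.
case=> [[[_]//|[px _]]|//].
by move: x0; rewrite /xcoord px ltxx.
Qed.

(** The arc could meet the sine curve only at [g 1], which is excluded because the abscissa is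
    strictly less than [wx0 R]. *)
Lemma sine_level m p : 0 < xcoord p < (trough R m)^-1 ->
  ycoord p = sin (xcoord p)^-1 -> level m p.
Proof.
move=> /andP[x0 xm] yx; have [_ _ g0 g1 gt] := arc.
have xw : xcoord p < wx0 R.
  rewrite wx0E (lt_le_trans xm)// lef_pV2 ?posrE ?trough_gt0//.
  by rewrite ler_trough.
split; first by rewrite x0.
move=> [t /andP[]]; rewrite le_eqVlt => /predU1P[<- _|t0].
  by rewrite g0 => p0; move: x0; rewrite /xcoord -p0 ltxx.
rewrite le_eqVlt => /predU1P[->|t1].
  by rewrite g1 => p0; move: xw; rewrite /xcoord -p0 ltxx.
move=> gtp; have [|] := gt t; first by rewrite t0.
rewrite gtp => + _; apply; split => //.
by apply/andP; split; [exact: x0|exact: ltW].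
Qed.

(** Consider the infimum [u] of the exit times: trapping keeps the path in the level at time [u],
    and openness keeps it there a little longer, which contradicts the choice of [u]. *)
Lemma level_short_path (p : R -> W) (m : nat) : continuous p ->
  (forall s t, 0 <= s <= 1 -> 0 <= t <= 1 ->
     `|ycoord (p s) - ycoord (p t)| < 2) ->
  level m.+1 (p 0) -> level m (p 1).
Proof.
move=> cp osc p0; apply: contrapT => np1.
pose C := [set t : R | 0 <= t <= 1 /\ ~ level m (p t)].
have C1 : C 1 by split; rewrite ?lexx ?ler01.
have Clb : has_lbound C by exists 0 => t [/andP[]].
have Cinf : has_inf C by split => //; exists 1.
pose u := inf C.
have u0 : 0 <= u by apply: lb_le_inf; [exists 1|move=> t [/andP[]]].
have u1 : u <= 1 by exact: ge_inf.
have before t : 0 <= t < u -> level m (p t).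
  move=> /andP[t0 tu]; apply: contrapT => npt.
  have : u <= t.
    by apply: ge_inf => //; split => //; rewrite t0 (le_trans (ltW tu)).
  by rewrite leNgt tu.
have pu : level m (p u).
  (* Trapping needs a nonempty interval before [u]; at [u] = 0 the starting level suffices. *)
  move: u0; rewrite le_eqVlt => /predU1P[<-|u0]; first exact: level_sub p0.
  have cx : continuous (xcoord \o p).
    by move=> t; apply: continuous_comp; [exact: cp|exact: continuous_xcoord].
  have cy : continuous (ycoord \o p).
    by move=> t; apply: continuous_comp; [exact: cp|exact: continuous_ycoord].
  have [] := @sine_curve_trapped R _ _ m cx cy osc (proj1 p0) u.
  - by rewrite u0.
  - move=> t /before pt; split; last exact: level_sine pt.
    by case: pt => /andP[].
  - exact: sine_level.
have /nbhs_ballP[e /= e0 pe] : nbhs u (p @^-1` level m).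
  by apply: cp; apply: open_nbhs_nbhs; split => //; exact: open_level.
have [t Ct tu] := inf_adherent e0 Cinf.
have ut : u <= t by exact: ge_inf.
case: Ct => _; apply; apply: pe.
rewrite /ball/= distrC ger0_norm ?subr_ge0// ltrBlDl.
exact: tu.
Qed.

Lemma crest_point n :
  warsaw_circle R g ((trough R n + pi)^-1, 1).
Proof.
have tn := trough_gt0 R n; have pi0 := pi_gt0 R.
have tnp := addr_gt0 tn pi0; have t0 := trough_gt0 R 0.
have t0n : trough R 0 <= trough R n by rewrite ler_trough.
left; left; split; last by rewrite /= invrK sin_crest.
by rewrite /= invr_gt0 tnp wx0E lef_pV2 ?posrE//; lra.
Qed.

Lemma segment_point : warsaw_circle R g (0, 1).
Proof. by left; right; split => //=; rewrite lexx; lra. Qed.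

Definition crest (n : nat) : W := SigSub (mem_set (crest_point n)).
Definition segment_top : W := SigSub (mem_set segment_point).

Lemma cvg_crest : crest @ \oo --> segment_top.
Proof.
have cv : (trough R n + pi)^-1 @[n --> \oo] --> 0.
  apply: (@squeeze_cvgr _ _ _ _ (fun=> 0) (@harmonic R)); last 2 first.
  - exact: cvg_cst.
  - exact: cvg_harmonic.
  apply: nearW => n; have tn := trough_gt R n; have pi0 := pi_gt0 R.
  have tp := addr_gt0 (trough_gt0 R n) pi0.
  by rewrite invr_ge0 (ltW tp)/= lef_pV2 ?posrE ?ltr0n//; lra.
move=> A [_ [[B oB <-] /= B0 BA]].
have [[P Q] /= [P0 Q1] PQ] : nbhs (0 : R, 1 : R) B by exact: open_nbhs_nbhs.
apply: (@filterS _ \oo _ _ _ _ (cv _ P0)) => n Pn; apply: BA; apply: PQ.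
by split => //; exact: nbhs_singleton Q1.
Qed.

(** Crest [n] sits between troughs [n] and [n.+1], so the atoms inside a level form a tail, whose
    mass is prescribed by [tau]. *)
Lemma level_crest m n : level m (crest n) <-> (m <= n)%N.
Proof.
have t0 := trough_gt0 R; have pi0 := pi_gt0 R.
have tp : 0 < trough R n + pi by exact: addr_gt0.
split=> [[/andP[_]]|mn].
  rewrite /xcoord/= ltf_pV2 ?posrE// => + _.
  rewrite leqNgt; apply: contraTN => nm; rewrite -leNgt.
  apply: (@le_trans _ _ (trough R n.+1)); last by rewrite ler_trough.
  by rewrite troughS lerDl ltW.
apply: sine_level; rewrite /xcoord /ycoord /=; last by rewrite invrK sin_crest.
by rewrite invr_gt0 tp ltf_pV2 ?posrE// ltr_pwDr// ler_trough.
Qed.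

End WarsawLevels.

Theorem theorem4 (R : realType) (g : R -> R * R) :
  warsaw_arc R g -> MT_H0_uncountable_dim R (Warsaw R g).
Proof.
move=> arc; pose W := Warsaw R g; pose I := set_type (`]0, 1[%classic : set R).
pose at_crest n : Sing R W 0 := cst_sing R (crest g n).
have cvg_at_crest : at_crest @ \oo --> cst_sing R (segment_top g).
  apply: continuous_cvg; last exact: cvg_crest.
  exact: continuous_cst_sing.
(* The constant simplices at the crests accumulate at the top of the segment; adding this limit
   gives a compact carrier common to all the chains. *)
pose K := range at_crest `|` [set cst_sing R (segment_top g)].
have I01 (i : I) : 0 < set_val i < 1.
  by have := set_valP i; rewrite /= in_itv.
pose tau (a : R) (n : nat) : R := harmonic n `^ a.
have atoms (i : I) : exists nu : set (Sing R W 0) -> R,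
    [/\ signed_borel_measure R _ nu,
    (forall A, (forall n, ~ A (at_crest n)) -> nu A = 0) &
    (forall A m, (forall n, A (at_crest n) <-> (m <= n)%N) ->
       nu A = tau (set_val i) m)].
  have /andP[i0 i1] := I01 i.
  apply: exists_atomic_measure => [n|].
    rewrite /tau ge0_ler_powR ?nnegrE ?harmonic_ge0 ?(ltW i0)//=.
    by rewrite lef_pV2 ?posrE ?ltr0n// ler_nat.
  rewrite (_ : tau _ = fun n => harmonic (1 * n)%N `^ set_val i).
    exact: harmonic_powR_cvg0.
  by apply/funext => n; rewrite mul1n.
have [nu nuP] := choice atoms.
exists I, nu; split.
- move=> cI.
  (* Uncountability of the index set follows from measure: a countable set is Lebesgue null, while
     the unit interval has measure 1. *)
  have : countable (`]0, 1[%classic : set R).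
    have -> : `]0, 1[%classic = (set_val : I -> R) @` setT.
      apply/seteqP; split => [x x01|_ [i _ <-]]; last exact: set_valP.
      by exists (SigSub (mem_set x01)).
    exact: card_le_trans (card_image_le _ _) cI.
  move/countable_lebesgue_measure0.
  rewrite lebesgue_measure_itv/= lte_fin ltr01.
  by rewrite sube0 => /eqP; rewrite eqe oner_eq0.
- move=> i; have [snu nu0 _] := nuP i; split => //.
  exists K; split; first exact: compact_cvg_range.
  by move=> A _ AK; apply: nu0 => n /AK; apply; left; exists n.
- move=> n f c injf c0 [mu [mu_chain mu_bd]].
  (* Evaluated on the levels [N * m], the supposed boundary gives a convergent series, whose terms
     are then rewritten as the divergent combination of powers. *)
  have [N [N0]] := is_cvg_series_mt_boundary (open_level arc)
    (fun m => level_sub (leqnSn m)) (@continuous_ycoord R g)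
    (@level_short_path R g arc) mu_chain.
  rewrite (_ : (fun _ => _) = fun m =>
      \sum_(j < n) c j * harmonic (N * m)%N `^ set_val (f j)).
    apply: dvg_series_harmonic_powR => // i j /val_inj; exact: injf.
  apply/funext => m; rewrite mu_bd; last first.
    by apply: borel_open; apply: open_Sing_ev; exact: open_level.
  apply: eq_bigr => j _; congr (_ * _).
  have [_ _ nu_tail] := nuP (f j).
  by apply: nu_tail => k; exact: level_crest.
Qed.
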